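(* Let $G$ be a finite group and let $H$ be a maximal subgroup of a maximal subgroup $M$ of $G$ such that $|G:M| = n$, where $n \in \mathcal{A}$ is odd. Then $H$ is a second maximal subgroup of $G$.
   Context: A second maximal subgroup of a finite group $G$ is a proper subgroup $H$ of $G$ such that $H$ is a maximal subgroup of every maximal subgroup of $G$ that contains $H$. A maximal subgroup of a group $X$ is a proper subgroup of $X$ not contained in any other proper subgroup of $X$. Let $S_n$ and $A_n$ denote the symmetric and alternating groups of degree $n$ (acting on $\{1,\ldots,n\}$), and define $$\mathcal{A} = \{ n \in \mathbb{N} : S_n \text{ and } A_n \text{ are the only primitive subgroups of } S_n \},$$ where a subgroup of $S_n$ is primitive if it is transitive on $\{1,\ldots,n\}$ and preserves no nontrivial partition of $\{1,\ldots,n\}$. *)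

(* Defs.v *)
From mathcomp Require Import all_boot all_fingroup all_solvable.

Set Implicit Arguments.
Unset Strict Implicit.
Unset Printing Implicit Defensive.

Local Open Scope group_scope.

Definition second_maximal (gT : finGroupType) (H G : {group gT}) : Prop :=
  H \proper G /\
  (forall M : {group gT}, maximal M G -> H \subset M -> maximal H M).

(* The degree-n permutation groups act on 'I_n = {0, ..., n-1}. "Only" is read
   as an inclusion, since 'Alt_('I_2) is not transitive; for n > 2 the groups
   'Sym_('I_n) and 'Alt_('I_n) are themselves primitive. *)
Definition only_trivial_primitive (n : nat) : Prop :=
  forall P : {group 'S_n},
    [primitive P, on [set: 'I_n] | 'P] ->
    P :=: 'Sym_('I_n) \/ P :=: 'Alt_('I_n).

(* Main.v *)
Require Import Defs.
From mathcomp Require Import all_boot all_fingroup all_solvable.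

(** Let [G] act on the [n] cosets of [M], with [x] the coset [M] itself.
Maximality of [M] makes the action primitive, so by the choice of [n] its image
contains the alternating group: all 3-cycles of points are induced by elements
of [G] ([primitive_three_cycles]).

Let [K <> M] be another maximal subgroup containing [H]; then [H = K :&: M] is
the stabiliser of [x] in [K]. Suppose [H < L < K]. The orbit [A] of [x] under
[L] is then a proper block of imprimitivity of [K] on the orbit of [x], and
[C = A k], for any [k] in [K] outside [L], is another block, of the same size
([point_stab_maximal]).
 - Some 3-cycle fixes [x] and does not preserve [A], so the stabiliser of [A]
   in [M] is proper; it contains [H], hence equals [H].
 - The set [A :|: C] has even cardinality [2 * #|A|], so when [n] is odd there
   is a point [d] outside it. A 3-cycle [(c c' d)] with [c], [c'] in [C] fixes
   [A] pointwise, so it lies in [H], hence in [K]; but it sends a point of the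
   block [C] into [C] and another one out of [C], which no element of [K] does.

The oddness of [n] is thus used exactly to exclude a [K] with just two
blocks. *)

Local Open Scope group_scope.

(** When [G] preserves [S], such a [g] must send [c] back to [a], so that it
induces the 3-cycle [(a b c)] on [S]. *)
Definition three_cycles_on {gT : finGroupType} {T : finType}
    (to : {action gT &-> T}) (G : {group gT}) (S : {set T}) : Prop :=
  {in S & &, forall a b c, uniq [:: a; b; c] ->
    exists2 g, g \in G & [/\ to a g = b, to b g = c &
      {in S, forall y, y \notin [:: a; b; c] -> to y g = y}]}.

(** If [L] lies strictly between [H] and [K], the [L]-orbit [A] of [x] is a
nontrivial block for [K], and maximality of [H] forces [H] to be the full
stabiliser of [A] in ['C_G[x | to]]. That stabiliser contains the 3-cycles
outside [A], one of which breaks a second block [C] of [K]. *)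
Lemma point_stab_maximal {gT : finGroupType} {T : finType}
    (to : {action gT &-> T}) (G H K : {group gT}) (x : T) :
  three_cycles_on to G (orbit to G x) -> odd #|orbit to G x| ->
  maximal H 'C_G[x | to] -> K \subset G -> 'C_K[x | to] = H -> H \proper K ->
  maximal H K.
Proof.
move=> cyc3 oddS maxH sKG defH ltHK; set S := orbit to G x in cyc3 oddS.
apply/maxgroupP; split=> // L ltLK sHL; apply/eqP/contraT=> neqLH.
have sLK := proper_sub ltLK; have [_ [k Kk L'k]] := properP ltLK.
have KS y : y \in K -> to x y \in S.
  by move=> Ky; rewrite mem_orbit ?(subsetP sKG).
have Hfix y : y \in K -> to x y = x -> y \in L.
  move=> Ky xy; apply: (subsetP sHL); rewrite -defH inE Ky.
  exact/astab1P.
have [l Ll xl]: exists2 l, l \in L & to x l != x.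
  have: ~~ (L \subset H) by apply: contra neqLH => sLH; rewrite eqEsubset sLH.
  case/subsetPn=> l Ll H'l; exists l => //; apply: contra H'l => /eqP xl.
  by rewrite -defH inE (subsetP sLK) //; apply/astab1P.
have Kl := subsetP sLK l Ll.
pose A := orbit to L x; pose C := (to^*)%act A k.
have Ax : x \in A by apply: orbit_refl.
have Al : to x l \in A by apply: mem_orbit.
have sAS : A \subset S by apply/imsetS/(subset_trans sLK).
have sCS : C \subset S.
  apply/subsetP=> _ /imsetP[_ /imsetP[m Lm ->] ->].
  by rewrite -actM; apply: KS; rewrite groupM // (subsetP sLK).
(* The block property: otherwise k would carry a point of A into A, and since
   the stabiliser of x in K lies in L, this would put k in L. *)
have AC y : y \in C -> y \notin A.
  case/imsetP=> _ /imsetP[m Lm ->] ->; apply: contra L'k => /imsetP[m' Lm' E].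
  rewrite -(groupMl k Lm) -(groupMr _ (groupVr Lm')).
  by rewrite Hfix ?groupM ?groupV // ?(subsetP sLK) // !actM E actK.
have sHK := proper_sub ltHK.
have Cc : to x k \in C by apply: imset_f.
have Cc' : to (to x l) k \in C by apply: imset_f.
have neqc : to x k != to (to x l) k by rewrite (inj_eq (act_inj _ _)) eq_sym.
have neqAC y z : y \in A -> z \in C -> y != z.
  by move=> Ay /AC; apply: contraNneq => <-.
(* Without a point d outside A and C, the orbit S would have 2 * #|A| points. *)
have [d Sd ACd]: exists2 d, d \in S & d \notin A :|: C.
  apply/subsetPn; apply: contraL oddS => sSAC.
  have ->: S = A :|: C by apply/eqP; rewrite eqEsubset sSAC subUset sAS.
  rewrite cardsU (_ : A :&: C = set0) ?cards0 ?subn0.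
    by rewrite card_setact addnn odd_double.
  by apply/setP=> y; rewrite !inE; apply/andP=> [[Ay /AC]]; rewrite Ay.
move: ACd; rewrite inE negb_or => /andP[A'd C'd].
have xS : x \in S by apply: orbit_refl.
have defN : 'C_G[x | to] :&: 'N(A | to) = H.
  have [_ maxH'] := maxgroupP maxH.
  apply: (maxH' [group of 'C_G[x | to] :&: 'N(A | to)]); last first.
    rewrite subsetI (proper_sub (maxgroupp maxH)).
    by rewrite (subset_trans sHL) // acts_orbit ?subsetT.
  rewrite properE subsetIl.
  (* The 3-cycle (x l, x k, x l k) fixes x and sends a point of A into C. *)
  have [||||g Gg [ag _ fixg]] := cyc3 (to x l) (to x k) (to (to x l) k).
  - exact: (subsetP sAS).
  - exact: KS.
  - by rewrite -actM; apply: KS; rewrite groupM.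
  - by rewrite /= !inE negb_or neqc (neqAC _ _ Al Cc) neqAC.
  apply/subsetPn; exists g.
    rewrite inE Gg; apply/astab1P/fixg; rewrite // !inE !negb_or.
    by rewrite eq_sym xl !neqAC.
  rewrite inE negb_and; apply/orP; right.
  apply/negP=> /astabs_act-/(_ (to x l)); rewrite ag Al.
  by apply/negP; rewrite AC.
have neqdC y : y \in C -> y != d by apply: contraTneq => ->.
(* The 3-cycle (c c' d) for the points c = x k and c' = x l k of C. *)
have [||||g Gg [cg c'g fixg]] := cyc3 (to x k) (to (to x l) k) d.
- exact: KS.
- by rewrite -actM; apply: KS; rewrite groupM.
- by [].
- by rewrite /= !inE negb_or neqc !neqdC.
have neqAd y : y \in A -> y != d by apply: contraTneq => ->.
have fixA y : y \in A -> to y g = y.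
  move=> Ay; rewrite fixg ?(subsetP sAS) // !inE !negb_or.
  by rewrite (neqAC _ _ Ay Cc) (neqAC _ _ Ay Cc') neqAd.
have Hg : g \in H.
  rewrite -defN; apply/setIP; split.
    by rewrite inE Gg; apply/astab1P/fixA.
  by rewrite !inE /=; apply/subsetP=> y Ay; rewrite inE fixA.
(* Both k * g and l * k send x to c', so k * g is a product h * l * k with h
   in H; hence k * g * k^-1 lies in L, which forces d = c' g into C = A k. *)
have Lkg : k * g * k^-1 \in L.
  rewrite -(groupMr _ (groupVr Ll)) Hfix //.
    by rewrite !groupM ?groupV // (subsetP sHK).
  by rewrite !actM cg !actK.
case/negP: C'd; rewrite -c'g.
have ->: to (to (to x l) k) g = to (to x (l * (k * g * k^-1))) k.
  by rewrite -!actM !mulgA mulgKV.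
by apply: imset_f; rewrite mem_orbit // groupM.
Qed.

(** Numbering the points of [S] turns the action into a homomorphism to the
symmetric group of degree [#|S|]. Its image [P] is primitive: point stabilisers
in [G] are the preimages of those in [P], because they contain the kernel, and
maximality passes through such preimages. By the hypothesis on [#|S|], [P] then
contains the alternating group, and 3-cycles are even. *)
Lemma primitive_three_cycles {gT : finGroupType} {T : finType}
    (to : {action gT &-> T}) (G : {group gT}) (S : {set T}) :
  [primitive G, on S | to] -> only_trivial_primitive #|S| ->
  three_cycles_on to G S.
Proof.
move=> primG trivS a b c Sa Sb Sc uniq_abc.
have trG : [transitive G, on S | to] by case/andP: primG.
have nSG : actby_cond G S to := atrans_acts trG.
have maxGa : maximal_eq 'C_G[a | to] G by rewrite -(trans_prim_astab Sa trG).
pose r := enum_rank_in Sa; pose v (i : 'I_#|S|) := enum_val i.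
(* An action must be by injections even for elements outside its domain; actby
   ensures this, letting such elements act trivially. *)
pose ito i g := r (<[nSG]>%act (v i) g).
have Sv i : v i \in S by apply: enum_valP.
have vr y : y \in S -> v (r y) = y by apply: enum_rankK_in.
have Sto i g : <[nSG]>%act (v i) g \in S.
  rewrite /= /actby Sv /=; case: ifP => // Gg.
  by rewrite (acts_act nSG).
have itoP : is_action G ito.
  split=> [g i j /(congr1 v)|i g h Gg Gh].
    by rewrite !vr // => /act_inj/enum_val_inj.
  by rewrite /ito vr // actMin.
pose iact := Action itoP; pose phi := [morphism of actperm iact].
have phiE g y : g \in G -> y \in S -> phi g (r y) = r (to y g).
  by move=> Gg Sy; rewrite actpermE /= /ito vr // actbyE.
have r_inj : {in S &, injective r} by apply: can_in_inj vr.
have primP : [primitive phi @* G, on [set: 'I_#|S|] | 'P].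
  rewrite (trans_prim_astab (in_setT (r a))).
    have -> : 'C_(phi @* G)[r a | 'P] = phi @* 'C_G[a | to].
      apply/setP=> s; apply/setIP/morphimP.
        case=> /morphimP[g _ Gg ->] /astab1P /=; rewrite /aperm phiE //.
        move=> /r_inj ag; exists g => //; rewrite inE Gg; apply/astab1P.
        by rewrite ag // (acts_act nSG).
      case=> g Gg /setIP[_ /astab1P ag] ->; split; first exact: mem_morphim.
      by apply/astab1P; rewrite /= /aperm phiE ?ag.
    have kerGa : 'ker phi \subset 'C_G[a | to].
      rewrite ker_actperm; apply/subsetP=> g kg; have [Gg _] := setIP kg.
      rewrite inE Gg; apply/astab1P/r_inj => //.
        by rewrite (acts_act nSG).
      by have := astab_act kg (in_setT (r a)); rewrite /= /ito vr // actbyE.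
    rewrite -(morphpre_maximal_eq (f:=phi)) ?morphimS ?subsetIl //.
    rewrite (morphimGK kerGa) ?subsetIl // morphimGK //.
    exact: subset_trans kerGa (subsetIl _ _).
  apply/imsetP; exists (r a) => //; apply/esym/setP=> i; rewrite inE.
  have [g Gg vi] := atransP2 trG Sa (Sv i).
  apply/imsetP; exists (phi g); first exact: mem_morphim.
  by rewrite /= /aperm phiE // -vi /r enum_valK_in.
have sAlt : 'Alt_('I_#|S|) \subset phi @* G.
  by case: (trivS _ primP) => ->; rewrite ?subsetT.
(* With permutations composed from left to right, s sends r a to r b and r b to
   r c. *)
pose s := tperm (r a) (r b) * tperm (r a) (r c).
move: uniq_abc; rewrite /= !inE andbT negb_or => /andP[/andP[ab ac] bc].
have neqr y z : y \in S -> z \in S -> y != z -> r y != r z.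
  by move=> Sy Sz; apply: contra => /eqP/r_inj->.
have /morphimP[g _ Gg sg] : s \in phi @* G.
  by apply: (subsetP sAlt); rewrite Alt_even odd_permM !odd_tperm !neqr.
have gE y z : y \in S -> z \in S -> s (r y) = r z -> to y g = z.
  move=> Sy Sz; rewrite sg phiE // => /r_inj-> //.
  by rewrite (acts_act nSG).
exists g => //; split=> [||y Sy]; try apply: gE => //; rewrite ?permM.
- by rewrite tpermL tpermD // neqr // eq_sym.
- by rewrite tpermR tpermL.
rewrite !inE !negb_or => /and3P[ya yb yc]; apply: gE => //.
by rewrite permM !tpermD // neqr // eq_sym.
Qed.

Theorem theorem2 (gT : finGroupType) (G M H : {group gT}) (n : nat) :
  maximal M G -> maximal H M ->
  #|G : M| = n -> odd n -> only_trivial_primitive n ->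
  second_maximal H G.
Proof.
move=> maxM maxH defn oddn trivn.
have [ltMG maxM'] := maxgroupP maxM; have [ltHM maxH'] := maxgroupP maxH.
have sMG := proper_sub ltMG.
split=> [|K maxK sHK]; first exact: proper_trans ltMG.
have [ltKG maxK'] := maxgroupP maxK.
have [eqKM | neqKM] := eqVneq (K : {set gT}) M; first by rewrite eqKM.
have defM : 'C_G[M : {set gT} | 'Rs] = M by rewrite astab1Rs (setIidPr sMG).
have orbM : orbit 'Rs G M = rcosets M G by rewrite orbitRs.
have trM : [transitive G, on rcosets M G | 'Rs].
  by apply/imsetP; exists (M : {set gT}); rewrite -?orbM ?orbit_refl.
have defH : 'C_K[M : {set gT} | 'Rs] = H.
  rewrite astab1Rs; apply: (maxH' [group of K :&: M]).
    rewrite properE subsetIr subsetI subxx andbT.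
    by apply: contra neqKM => sMK; rewrite [K : {set _}](maxM' _ ltKG).
  by rewrite subsetI sHK proper_sub.
apply: (point_stab_maximal 'Rs%act G H K (M : {set gT})).
- rewrite orbM; apply: primitive_three_cycles; last first.
    by rewrite -[#|_|]/#|G : M| defn.
  rewrite (trans_prim_astab (x := M : {set gT})) -?orbM ?orbit_refl ?orbM //.
  by rewrite defM /maximal_eq maxM orbT.
- by rewrite orbM -[#|_|]/#|G : M| defn.
- by rewrite defM.
- exact: proper_sub.
- by [].
rewrite properE sHK; apply: contra neqKM => sKH.
by rewrite eq_sym [M : {set _}](maxK' _ ltMG) // (subset_trans sKH) ?proper_sub.
Qed.
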